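(* Let $p,q,r$ be integers with $p\ge r>0$, $q>0$ and $[p]_q=1$. Then: (1) if $1\le [r]_{2q}\le q$, then $NC(p,q;r,q)=\gcd([r]_{2q},\,1-q)$; (2) if $q+1\le [r]_{2q}\le 2q-1$, then $NC(p,q;r,q)=\gcd([r]_{2q}+2,\,q+1)$; (3) if $1<r\le q$, then $NC(p,q;r,-q)=\gcd(r,\,q+1)$.
   Context: For positive integers $p\ge r>0$ and integers $q,s$, the twisted torus link $T(p,q;r,s)$ is the closure of the braid on $p$ strands $(\sigma_1\sigma_2\cdots\sigma_{p-1})^q(\sigma_1\cdots\sigma_{r-1})^s$, where $\sigma_1,\dots,\sigma_{p-1}$ are the standard generators of the braid group on $p$ strands (an empty product is the trivial braid). $NC(p,q;r,s)$ denotes the number of components of the link $T(p,q;r,s)$. For an integer $x$ and a positive integer $m$, $[x]_m\in\{0,1,\dots,m-1\}$ denotes the residue of $x$ modulo $m$. The gcd is taken non-negative, with $\gcd(a,0)=|a|$. *)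

(* Defs.v *)
From HB Require Import structures.
From mathcomp Require Import all_boot all_order all_algebra finmap.
From mathcomp Require Import all_classical all_reals all_analysis.
Import Order.TTheory GRing.Theory Num.Theory.
Import numFieldNormedType.Exports.

Set Implicit Arguments.
Unset Strict Implicit.
Unset Printing Implicit Defensive.

Local Open Scope classical_set_scope.
Local Open Scope ring_scope.

(* The letter (i, false) is the generator sigma_i (indexed from 1, as are the
   strands) and (i, true) is its inverse. *)
Definition letter : Type := nat * bool.

Definition braid_word : Type := seq letter.

Definition word_inv (w : braid_word) : braid_word :=
  rev [seq (a.1, ~~ a.2) | a <- w].

Definition word_exp (w : braid_word) (z : int) : braid_word :=
  match z with
  | Posz n => flatten (nseq n w)
  | Negz n => flatten (nseq n.+1 (word_inv w))
  end.

(* sigma_1 sigma_2 ... sigma_(m-1) *)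
Definition row_word (m : nat) : braid_word :=
  [seq (i, false) | i <- iota 1 m.-1].

Definition twisted_torus_word (p : nat) (q : int) (r : nat) (s : int) :
    braid_word :=
  word_exp (row_word p) q ++ word_exp (row_word r) s.

(* None stands for a trivial slab, in which all strands are parallel. *)
Definition exit_position (a : option letter) (j : nat) : nat :=
  if a is Some (i, _) then
    if j == i then i.+1 else if j == i.+1 then i else j
  else j.

(* Position, at height u in [0, 1] of a slab containing the single letter a, of
   the strand that enters the slab at (j, 0).  At a crossing of the strands i
   and i+1, strand i is pushed out of the plane, to one side or to the other
   according to the sign of the letter. *)
Definition strand (R : realType) (a : option letter) (j : nat) (u : R) : R * R :=
  ((1 - u) * j%:R + u * (exit_position a j)%:R,
   if a is Some (i, b) then
     if j == i then (-1) ^+ b * (u * (1 - u)) else 0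
   else 0).

(* The closure, around the z-axis, of the braid on p strands given by the word w
   (whose generators should be among sigma_1, ..., sigma_(p-1)): the slabs are
   the successive angular sectors 0, ..., size w about the axis.  Sector k < size w
   contains the k-th letter of w; in the last one, onth w (size w) = None, and
   the end points of the braid are joined to its starting points by parallel
   arcs. *)
Definition closed_braid (R : realType) (p : nat) (w : braid_word) :
    set (R * R * R) :=
  [set P | exists (k j : nat) (u : R),
    [/\ (k <= size w)%N, (1 <= j <= p)%N, 0 <= u <= 1 &
        let: (x, y) := strand (onth w k) j u in
        let t := 2 * pi * (k%:R + u) / (size w).+1%:R in
        P = (x * cos t, x * sin t, y)]].
Arguments closed_braid : clear implicits.

Definition twisted_torus_link (R : realType) (p : nat) (q : int) (r : nat)
    (s : int) : set (R * R * R) :=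
  closed_braid R p (twisted_torus_word p q r s).
Arguments twisted_torus_link : clear implicits.

Definition link_components (R : realType) (L : set (R * R * R)) :
    set (set (R * R * R)) :=
  [set connected_component L x | x in L].

(* fset_set sends an infinite set to fset0, so this is 0 if there are infinitely
   many components; that does not happen for a closed braid. *)
Definition NC (R : realType) (p : nat) (q : int) (r : nat) (s : int) : nat :=
  #|` fset_set (link_components (twisted_torus_link R p q r s))|%fset.

(* Main.v *)
Require Import Defs.
From mathcomp Require Import all_boot all_order all_algebra finmap.
From mathcomp Require Import all_classical all_reals all_analysis.
From mathcomp Require Import zify ring lra.
Import Order.TTheory GRing.Theory Num.Theory.
Import numFieldNormedType.Exports.

Set Implicit Arguments.
Unset Strict Implicit.
Unset Printing Implicit Defensive.

Local Open Scope classical_set_scope.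
Local Open Scope ring_scope.

(* The components of a closed braid are the orbits of its permutation: the arcs
   of one orbit are chained end to end, and the arcs of distinct orbits form
   disjoint compact sets.  With strands numbered from 0, the permutation of
   T(p,q;r,s) is x |-> x - q mod p followed, below r, by x |-> x - s mod r.
   Passing to first-return maps preserves the number of orbits.  For p = kq + 1
   one removes multiples of q from p as long as p - q >= max(r, q).  If r <= q,
   this ends at p = q + 1, and the return map to [0, r) is the rotation by
   1 - s.  If r > q and s = q, it ends at p = r + t with 0 <= t < q.  For t = 0
   the permutation is the rotation by -2q mod p.  For t > 0 one returns first to
   [0, 2q), and then, according to the parity of k, to [q + 1 - t, q), where the
   map is the rotation by q + 1 mod t - 1, or to [0, q + 1 - t), where it is the
   rotation by 1 - q. *)

(** * Counting orbits by first-return maps *)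

Section OrbitCount.
Local Open Scope nat_scope.

(* For a permutation of a finite set this is the relation of lying on the same
   cycle; as a symmetric relation it makes sense for every map. *)
Definition merge_orbits (T : Type) (f : T -> T) (x y : T) : Prop :=
  exists i j, iter i f x = iter j f y.

(** Counting by an explicit labelling avoids quotients; the labels later index the pieces of the
    link. *)
Definition orbit_count (T : Type) (D : T -> Prop) (f : T -> T) (N : nat) :
    Prop :=
  exists lab : T -> nat,
    [/\ forall x, D x -> lab x < N,
        forall c, c < N -> exists2 x, D x & lab x = c &
        forall x y, D x -> D y -> lab x = lab y <-> merge_orbits f x y].

Section Orbits.
Variables (T : Type) (f : T -> T).

Lemma merge_orbits_refl x : merge_orbits f x x.
Proof. by exists 0, 0. Qed.

Lemma merge_orbits_sym x y : merge_orbits f x y -> merge_orbits f y x.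
Proof. by move=> [i [j e]]; exists j, i. Qed.

Lemma merge_orbits_trans x y z :
  merge_orbits f x y -> merge_orbits f y z -> merge_orbits f x z.
Proof.
move=> [i [j e]] [k [l e']]; exists (k + i), (j + l).
by rewrite !iterD e -e' -!iterD addnC.
Qed.

Lemma merge_orbits_step x : merge_orbits f (f x) x.
Proof. by exists 0, 1. Qed.

(* [rho x] is the first point of the section [iota] met by the orbit of [x], and
   [g] is the first-return map. *)
Lemma orbit_count_return (D : T -> Prop) (m : nat) (g : nat -> nat)
    (iota : nat -> T) (rho : T -> nat) (mu : T -> nat) (N : nat) :
  (forall x, D x -> D (f x)) ->
  (forall y, y < m -> D (iota y)) ->
  (forall y, y < m -> rho (iota y) = y) ->
  (forall y, y < m -> rho (f (iota y)) = g y) ->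
  (forall x, D x -> rho x < m) ->
  (forall x, D x -> x = iota (rho x) \/ rho (f x) = rho x /\ mu (f x) < mu x) ->
  orbit_count (fun y => y < m) g N -> orbit_count D f N.
Proof.
move=> Df Di rhoi rhof rhom step [lab [labN labS labE]].
have g_lt y : y < m -> g y < m by move=> ym; rewrite -rhof//; apply/rhom/Df/Di.
(* Outside the section [mu] drops while [rho] stays fixed, so the orbit of [x] reaches
   [iota (rho x)]. *)
have merge_rho x : D x -> merge_orbits f x (iota (rho x)).
  have [n] := ubnP (mu x); elim: n x => // n IH x mun Dx.
  have [<-|[rx mx]] := step x Dx; first exact: merge_orbits_refl.
  apply: (merge_orbits_trans (merge_orbits_sym (merge_orbits_step x))).
  by rewrite -rx; apply: IH (Df _ Dx); lia.
(* Along an [f]-orbit, [rho] advances by [g] on the section and stands still elsewhere. *)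
have rho_iter x i : D x -> D (iter i f x) /\
    exists i', rho (iter i f x) = iter i' g (rho x).
  move=> Dx; elim: i => [|i [Di' [i' e]]]; first by split=> //; exists 0.
  split; first exact: Df.
  have [xE|[rx _]] := step _ Di'; last by exists i'; rewrite iterS rx.
  by exists i'.+1; rewrite !iterS {1}xE rhof ?e // -e rhom.
have merge_iter k y : y < m -> iter k g y < m /\
    merge_orbits f (iota y) (iota (iter k g y)).
  move=> ym; elim: k => [|k [km mk]]; first by split; [|exact: merge_orbits_refl].
  split; first exact: g_lt.
  apply: (merge_orbits_trans mk).
  apply: (merge_orbits_trans (merge_orbits_sym (merge_orbits_step _))).
  by rewrite iterS -rhof //; apply/merge_rho/Df/Di.
exists (lab \o rho); split => [x Dx|c cN|x y Dx Dy] /=.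
- exact/labN/rhom.
- have [y ym <-] := labS c cN; exists (iota y); first exact: Di.
  by rewrite rhoi.
- rewrite labE; [|exact: rhom..]; split=> [[i [j e]]|[i [j e]]].
    apply: (merge_orbits_trans (merge_rho x Dx)).
    apply: merge_orbits_sym; apply: (merge_orbits_trans (merge_rho y Dy)).
    have [_ hx] := merge_iter i (rho x) (rhom x Dx).
    have [_ hy] := merge_iter j (rho y) (rhom y Dy).
    by apply: (merge_orbits_trans hy); rewrite -e; exact: merge_orbits_sym.
  have [_ [i' ei]] := rho_iter x i Dx; have [_ [j' ej]] := rho_iter y j Dy.
  by exists i', j'; rewrite -ei -ej e.
Qed.

Lemma eq_orbit_count (D : T -> Prop) (g : T -> T) (N : nat) :
  (forall x, D x -> D (f x)) -> (forall x, D x -> f x = g x) ->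
  orbit_count D g N -> orbit_count D f N.
Proof.
move=> Df fg [lab [labN labS labE]].
have it i x : D x -> iter i f x = iter i g x /\ D (iter i f x).
  move=> Dx; elim: i => //= i [e Di]; split; last exact: Df.
  by rewrite fg // e.
exists lab; split=> // x y Dx Dy; rewrite labE //.
by split=> -[i [j e]]; exists i, j; move: e;
   rewrite (proj1 (it i x Dx)) (proj1 (it j y Dy)).
Qed.
End Orbits.

(** The orbits are the residue classes modulo the gcd: the rotation preserves that residue, and
    Bezout connects points with equal residues. *)
Lemma orbit_count_rotation (m d : nat) : 0 < m ->
  orbit_count (fun x => x < m) (fun x => (x + d) %% m) (gcdn m d).
Proof.
move=> m0; have g0 : 0 < gcdn m d by rewrite gcdn_gt0 m0.
have gm : gcdn m d %| m := dvdn_gcdl m d.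
have it i x : x < m -> iter i (fun x => (x + d) %% m) x = (x + i * d) %% m.
  move=> xm; elim: i => [|i IH] /=; first by rewrite addn0 modn_small.
  by rewrite IH modnDml mulSn -addnA (addnC d).
exists (fun x => x %% gcdn m d); split=> [x _|c cg|x y xm ym].
- by rewrite ltn_mod.
- by exists c; rewrite ?modn_small //; apply: leq_trans cg (dvdn_leq m0 gm).
have modg a : a %% m = a %[mod gcdn m d] by rewrite modn_dvdm.
split=> [e|[i [j]]]; last first.
  rewrite !it // => /(congr1 (modn^~ (gcdn m d))) /=; rewrite !modg.
  have /dvdnP[k dE] := dvdn_gcdr m d.
  have modi a z : z + a * d = z %[mod gcdn m d].
    by rewrite {1}dE mulnA addnC modnMDl.
  by rewrite !modi.
wlog xy : x y xm ym e / x <= y => [W|].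
  by case/orP: (leq_total x y) => h; [|apply: merge_orbits_sym]; apply: W.
have [k yE] : exists k, y = x + k * gcdn m d.
  have /dvdnP[k kE] : gcdn m d %| y - x by rewrite -eqn_mod_dvd ?e.
  by exists k; rewrite -kE subnKC.
have [d0|d0] := posnP d.
  exists 0, 0; move: ym; rewrite /= yE d0 gcdn0.
  by case: k {yE} => [|k]; [rewrite addn0|rewrite mulSn; lia].
(* Here [a * d = b * m + gcdn d m], so [k * a] rotations move [x] by [k] times the gcd. *)
have [a b bE _] := egcdnP m d0.
rewrite gcdnC in bE.
exists (k * a), 0; rewrite !it // mul0n addn0 yE -mulnA bE mulnDr addnCA mulnA.
by rewrite modnMDl.
Qed.

End OrbitCount.

(** * The permutation of a twisted torus link *)

Section TorusPermutation.
Local Open Scope nat_scope.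

Section TorusStep.
Variables (q r : nat) (R : nat -> nat).
Hypothesis Rlt : forall x, x < r -> R x < r.
Hypothesis Rid : forall x, r <= x -> R x = x.

(** [R] stands for the twist below [r]; its argument is [x - q] modulo [p] when [x < p] and
    [q <= p]. *)
Definition torus_map (p x : nat) : nat :=
  R (if x < q then x + p - q else x - q).

Lemma torus_map_lt p x : r <= p -> q <= p -> x < p -> torus_map p x < p.
Proof.
rewrite /torus_map => rp qp xp; case: (ltnP x q) => h.
  case: (ltnP (x + p - q) r) => h'; first by have := Rlt h'; lia.
  by rewrite Rid //; lia.
case: (ltnP (x - q) r) => h'; first by have := Rlt h'; lia.
by rewrite Rid //; lia.
Qed.

(** A point [y < q] first goes to [y + p], where [R] is the identity, then to [R (y + p - q)], its
    image for [p]. Points of [[p, p + q)] return to [[0, p)] in one step. *)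
Lemma torus_map_reduce p N : r <= p -> q <= p ->
  orbit_count (fun x => x < p) (torus_map p) N ->
  orbit_count (fun x => x < p + q) (torus_map (p + q)) N.
Proof.
move=> rp qp.
have Rp x : x < p -> R x < p.
  by move=> xp; case: (ltnP x r) => h; [have := Rlt h; lia|rewrite Rid].
apply: (orbit_count_return (iota := id)
  (rho := fun x => if x < p then x else R (x - q)) (mu := fun x => p <= x)).
- by move=> x; apply: torus_map_lt; lia.
- by move=> y yp; lia.
- by move=> y ->.
- move=> y yp; rewrite /torus_map; case: (ltnP y q) => h.
    by rewrite Rid; [rewrite ifF; [congr R; lia|lia]|lia].
  by rewrite Rp //; lia.
- by move=> x xp; case: (ltnP x p) => // h; apply: Rp; lia.
- move=> x xp; case: (ltnP x p) => h; [by left|right].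
  have -> : torus_map (p + q) x = R (x - q) by rewrite /torus_map ifF //; lia.
  have xq : R (x - q) < p by apply: Rp; lia.
  by rewrite xq; split=> //; lia.
Qed.

Lemma torus_map_reduce_iter p k N : r <= p -> q <= p ->
  orbit_count (fun x => x < p) (torus_map p) N ->
  orbit_count (fun x => x < p + k * q) (torus_map (p + k * q)) N.
Proof.
move=> rp qp cN; elim: k => [|k IH]; first by rewrite addn0.
by rewrite mulSnr addnA; apply: torus_map_reduce; rewrite // -?addnA; lia.
Qed.

(** Modulo [q + 1] the shift by [-q] is the successor. Points outside [[0, r)] climb to [q], wrap to
    0 and return at [R 0], which is also the return value of [r - 1]. *)
Lemma torus_map_small N : 0 < r <= q ->
  orbit_count (fun x => x < r) (fun x => R (x.+1 %% r)) N ->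
  orbit_count (fun x => x < q + 1) (torus_map (q + 1)) N.
Proof.
move=> /andP[r0 rq].
have fE x : x < q + 1 -> torus_map (q + 1) x = R (if x < q then x.+1 else 0).
  by move=> xq; rewrite /torus_map; case: ltnP => h; congr R; lia.
have R0 := Rlt r0.
apply: (orbit_count_return (iota := id)
  (rho := fun x => if x < r then x else R 0)
  (mu := fun x => if x < r then 0 else q + 1 - x)).
- by move=> x; apply: torus_map_lt; lia.
- by move=> y yr; lia.
- by move=> y ->.
- move=> y yr; have yq : y < q by lia.
  rewrite fE ?yq; last lia.
  have [yr'|yr'] := ltnP y.+1 r; first by rewrite modn_small // Rlt.
  have -> : y.+1 = r by lia.
  by rewrite Rid // ltnn modnn.
- by move=> x _; case: (ltnP x r).
- move=> x xq; case: (ltnP x r) => h; [by left|right].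
  rewrite fE //; case: (ltnP x q) => h'; last by rewrite R0; split=> //; lia.
  have xr : x.+1 < r = false by lia.
  by rewrite Rid ?xr; [split=> //; lia|lia].
Qed.
End TorusStep.

Definition rot_below (r s x : nat) : nat := if x < r then (x + s) %% r else x.

Lemma rot_below_lt r s x : x < r -> rot_below r s x < r.
Proof. by move=> xr; rewrite /rot_below xr ltn_mod (leq_ltn_trans _ xr). Qed.

Lemma rot_below_id r s x : r <= x -> rot_below r s x = x.
Proof. by rewrite /rot_below leqNgt => /negbTE ->. Qed.

(** [(m - 1) * q] represents [-q] modulo [m], which keeps downward rotations within [nat]. *)
Lemma modn_down m q x : q <= m -> x < m ->
  (x + (m - 1) * q) %% m = if x < q then x + m - q else x - q.
Proof.
move=> qm xm; case: ltnP => h.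
  have -> : x + (m - 1) * q = (q - 1) * m + (x + m - q).
    by case: q m => [|q] [|m] // in qm xm h *; lia.
  by rewrite modnMDl modn_small //; lia.
have -> : x + (m - 1) * q = q * m + (x - q).
  by case: m => [|m] // in qm xm *; lia.
by rewrite modnMDl modn_small //; lia.
Qed.

(** * Twists with exponent [q] on [r = p - t] strands, [0 < t < q] *)

Section BigTwist.
Variables (q p r t : nat).
Hypotheses (t0 : 0 < t) (tq : t < q) (pq : 2 * q < p) (rt : r + t = p).

Local Notation f := (torus_map q (rot_below r ((r - 1) * q)) p).

Lemma big_twistE x : x < p -> f x =
  if 2 * q <= x then x - 2 * q else if q <= x then x + r - 2 * q
  else if x < q - t then x + p - 2 * q else x + p - q.
Proof.
move=> xp; have twE y : rot_below r ((r - 1) * q) y =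
    if y < r then (if y < q then y + r - q else y - q) else y.
  by rewrite /rot_below; case: (ltnP y r) => // h; rewrite modn_down //; lia.
by rewrite /torus_map twE; repeat case: ifP; lia.
Qed.

(** From [2 * q] on the map subtracts [2 * q], so a point returns to [[0, 2 * q)] at its residue. *)
Lemma big_twist_mod N :
  orbit_count (fun x => x < 2 * q) (fun x => f x %% (2 * q)) N ->
  orbit_count (fun x => x < p) f N.
Proof.
have flt x : x < p -> f x < p.
  by move=> xp; rewrite big_twistE //; repeat case: ifP; lia.
apply: (orbit_count_return (iota := id) (rho := modn^~ (2 * q)) (mu := id)) => //.
- by move=> y; lia.
- by move=> y yq; rewrite modn_small.
- by move=> x _; rewrite ltn_mod; lia.
- move=> x xp; case: (ltnP x (2 * q)) => h; [left|right].
    by rewrite modn_small.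
  rewrite big_twistE // h; split; last lia.
  by rewrite -{2}(subnK h) modnDr.
Qed.

(** With [m = t - 1], the section is [[q - m, q)]. Points from [q] on descend into it by steps of
    [m]; those below it climb to [q - t], jump to [2 * q - m] and descend from there. *)
Lemma big_twist_even h : p = 2 * q * h + 1 -> 1 < t ->
  orbit_count (fun x => x < p) f (gcdn (t - 1) (q + 1)).
Proof.
move=> pE t1; apply: big_twist_mod; set m := t - 1.
have gE x : x < 2 * q -> f x %% (2 * q) =
    if q <= x then x - m else if x < q - t then x.+1
    else if x == q - 1 then 0 else x + q + 1.
  move=> xq; rewrite big_twistE; last lia.
  rewrite ifF; last lia.
  have h0 : 0 < h by case: h pE => // ; lia.
  have -> : (if q <= x then x + r - 2 * q else
     if x < q - t then x + p - 2 * q else x + p - q) =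
     (h - 1) * (2 * q) + (if q <= x then x + 1 - t else
                       if x < q - t then x.+1 else x + q + 1).
    have E : 2 * q * h = (h - 1) * (2 * q) + 2 * q by nia.
    by repeat case: ifP; lia.
  rewrite modnMDl; case: ifP => h1; first by rewrite modn_small; lia.
  case: ifP => h2; first by rewrite modn_small; lia.
  case: eqP => h3; last by rewrite modn_small; lia.
  have -> : x + q + 1 = 2 * q by lia.
  by rewrite modnn.
have m0 : 0 < m by lia.
(* Below the section the measure exceeds [2 * q], so that it still drops at the jump. *)
apply: (orbit_count_return (iota := fun y => (q - m) + y)
  (rho := fun x => if x < q - m then q %% m else (x - (q - m)) %% m)
  (mu := fun x => if x < q - m then 2 * q + q - x else x)
  (g := fun y => (y + (q + 1)) %% m)); last exact: orbit_count_rotation.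
- by move=> x _; rewrite ltn_mod; lia.
- by move=> y ym; lia.
- by move=> y ym; rewrite ifF ?addKn ?modn_small //; lia.
- move=> y ym; rewrite gE; last lia.
  have -> : q <= q - m + y = false by lia.
  have -> : q - m + y < q - t = false by lia.
  (* The top point [q - 1] wraps to 0, whose return residue is [q]; this agrees with [q + m] modulo
     [m]. *)
  case: eqP => e; last by rewrite ifF; [congr modn; lia|lia].
  rewrite ifT; last lia.
  have -> : y + (q + 1) = q + m by lia.
  by rewrite modnDr.
- by move=> x _; case: ifP; rewrite ltn_mod.
- move=> x xq; rewrite gE //.
  case: (leqP q x) => h1.
    right; have -> : x < q - m = false by lia.
    have -> : x - m < q - m = false by lia.
    split; last lia.
    by rewrite -[in RHS](subnK (_ : m <= x - (q - m)));
      [rewrite modnDr; congr modn|]; lia.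
  case: (ltnP x (q - m)) => h2; last by left; rewrite modn_small; lia.
  right; case: (ltnP x (q - t)) => h3.
    by rewrite ifT; [split=> //; rewrite ifT|]; lia.
  have -> : x == q - 1 = false by lia.
  have -> : x + q + 1 < q - m = false by lia.
  by split; [congr modn|]; lia.
Qed.

(** With [m = q + 1 - t], the section is [[0, m)]. Points from [q] on climb by [m] past [2 * q],
    returning at [x - 2 * q] modulo [m]; points of [[m, q)] climb by one to [q]. Since
    [2 * q * (m - 1)] represents [-2 * q], the rotation is by [1 - q]. *)
Lemma big_twist_odd h : p = 2 * q * h + q + 1 ->
  orbit_count (fun x => x < p) f
    (gcdn (q + 1 - t) (q + 1 + 2 * q * (q + 1 - t - 1))).
Proof.
move=> pE; apply: big_twist_mod; set m := q + 1 - t.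
have gE x : x < 2 * q -> f x %% (2 * q) =
    if q <= x then (if x + m < 2 * q then x + m else x + m - 2 * q)
    else if x < m - 1 then x + q + 1 else x.+1.
  move=> xq; rewrite big_twistE; last lia.
  rewrite ifF; last lia.
  have h0 : 0 < h by case: h pE => // ; lia.
  have -> : (if q <= x then x + r - 2 * q else
     if x < q - t then x + p - 2 * q else x + p - q) =
     (h - 1) * (2 * q) + (if q <= x then x + m else
                       if x < q - t then x + q + 1 else x.+1 + 2 * q).
    have E : 2 * q * h = (h - 1) * (2 * q) + 2 * q by nia.
    by repeat case: ifP; lia.
  rewrite modnMDl; case: ifP => h1.
    case: ifP => h2; first by rewrite modn_small.
    rewrite -[in LHS](subnK (_ : 2 * q <= x + m)); last lia.
    by rewrite modnDr modn_small; lia.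
  case: ifP => h2; first by rewrite ifT ?modn_small; lia.
  by rewrite ifF; [rewrite modnDr modn_small|]; lia.
have m0 : 0 < m by lia.
apply: (orbit_count_return (iota := id)
  (rho := fun x => if x < m then x else
     if x < q then (q + 2 * q * (m - 1)) %% m else (x + 2 * q * (m - 1)) %% m)
  (mu := fun x => if x < m then 0 else 2 * q - x)
  (g := fun y => (y + (q + 1 + 2 * q * (m - 1))) %% m));
  last exact: orbit_count_rotation.
- by move=> x _; rewrite ltn_mod; lia.
- by move=> y ym; lia.
- by move=> y ->.
- move=> y ym; rewrite gE; last lia.
  case: (leqP q y) => h1; first lia.
  case: (ltnP y (m - 1)) => h2.
    by rewrite ifF; [rewrite ifF; [congr modn|]|]; lia.
  have yE : y.+1 = m by lia.
  rewrite yE ltnn.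
  have -> : y + (q + 1 + 2 * q * (m - 1)) = m + (q + 2 * q * (m - 1)) by lia.
  rewrite [in RHS]modnDl; case: (ltnP m q) => // h3.
  by congr modn; lia.
- by move=> x _; case: (ltnP x m) => // _; case: ifP; rewrite ltn_mod.
- move=> x xq; case: (ltnP x m) => h1; [by left|right].
  rewrite gE //; case: (leqP q x) => h2.
    case: (ltnP (x + m) (2 * q)) => h3.
      have -> : x + m < m = false by lia.
      have -> : x + m < q = false by lia.
      by split; [rewrite addnAC modnDr|lia].
    have h4 : x + m - 2 * q < m by lia.
    rewrite h4; split; last lia.
    have -> : x + 2 * q * (m - 1) = (2 * q - 1) * m + (x + m - 2 * q) by nia.
    by rewrite modnMDl modn_small.
  have -> : x < m - 1 = false by lia.
  have -> : x.+1 < m = false by lia.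
  split; last lia.
  by case: (ltnP x.+1 q) => // h3; have -> : x.+1 = q by lia.
Qed.
End BigTwist.

(** Here [a] is [-b] modulo [m]; this undoes the encodings of negative shifts. *)
Lemma gcdn_opp m a b : m %| a + b -> gcdn m a = gcdn m b.
Proof.
move=> dv; have dvg d : d %| m -> (d %| a) = (d %| b).
  move=> dm; have dab := dvdn_trans dm dv.
  by apply/idP/idP => h; move: dab; [rewrite dvdn_addr|rewrite dvdn_addl].
apply/eqP; rewrite eqn_dvd !dvdn_gcd !dvdn_gcdl /=.
by rewrite -dvg ?dvdn_gcdl // dvdn_gcdr dvg ?dvdn_gcdl // dvdn_gcdr.
Qed.

(** Here [q] is the exponent itself, whereas [s] is a shift: minus the second exponent, modulo
    [r]. *)
Definition torus_perm (p q r s x : nat) : nat :=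
  rot_below r s ((x + (p - 1) * q) %% p).

Lemma torus_perm_lt p q r s x : r <= p -> x < p -> torus_perm p q r s x < p.
Proof.
move=> rp xp; rewrite /torus_perm.
have : (x + (p - 1) * q) %% p < p by rewrite ltn_mod; lia.
move: (_ %% p) => y yp; case: (ltnP y r) => h; last by rewrite rot_below_id.
by apply: leq_trans rp; exact: rot_below_lt.
Qed.

Lemma torus_permE p q r s x : q <= p -> x < p ->
  torus_perm p q r s x = torus_map q (rot_below r s) p x.
Proof. by move=> qp xp; rewrite /torus_perm /torus_map modn_down. Qed.

Lemma torus_perm_small k q r s : 0 < r <= q ->
  orbit_count (fun x => x < k.+1 * q + 1) (torus_perm (k.+1 * q + 1) q r s)
    (gcdn r (s + 1)).
Proof.
move=> /andP[r0 rq].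
apply: (eq_orbit_count (g := torus_map q (rot_below r s) (k.+1 * q + 1))).
- by move=> x; apply: torus_perm_lt; nia.
- by move=> x xp; apply: torus_permE => //; nia.
have -> : k.+1 * q + 1 = q + 1 + k * q by lia.
have lt := @rot_below_lt r s; have id := @rot_below_id r s.
apply: (torus_map_reduce_iter lt id); [lia..|].
apply: (torus_map_small lt id); first by rewrite r0.
apply: eq_orbit_count (orbit_count_rotation (s + 1) r0) => x xr.
  by apply: lt; rewrite ltn_mod.
by rewrite /rot_below ltn_mod r0 modnDml addnCA addnC addn1 addnS.
Qed.

Lemma torus_perm_down_full p q : 0 < p -> q <= p ->
  orbit_count (fun x => x < p) (torus_map q (rot_below p ((p - 1) * q)) p)
    (gcdn p (2 * q)).
Proof.
move=> p0 qp.
have -> : gcdn p (2 * q) = gcdn p (2 * ((p - 1) * q)).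
  apply: gcdn_opp; have -> : 2 * q + 2 * ((p - 1) * q) = 2 * q * p.
    by case: p => [|p] // in p0 qp *; lia.
  exact: dvdn_mull.
apply: eq_orbit_count (orbit_count_rotation _ p0) => x xp.
  by rewrite -torus_permE //; apply: torus_perm_lt.
rewrite -torus_permE // /torus_perm /rot_below ltn_mod p0 modnDml.
by congr modn; lia.
Qed.

(** For [r > q], the strand number reduces to [n * q + 1 = r + t] with [t < q]. If [t > 0], then [r]
    modulo [2 * q] is [2 * q + 1 - t] for even [n] ([t = 1] being excluded) and [q + 1 - t] for odd
    [n], which separates the two formulas. *)
Lemma torus_perm_down k q r : 1 < q -> 0 < r -> r <= k.+1 * q + 1 ->
  r %% (2 * q) != 0 ->
  orbit_count (fun x => x < k.+1 * q + 1)
    (torus_perm (k.+1 * q + 1) q r ((r - 1) * q))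
    (if r %% (2 * q) <= q then gcdn (r %% (2 * q)) (q - 1)
     else gcdn (r %% (2 * q) + 2) (q + 1)).
Proof.
move=> q1 r0 rp rn0; case: (leqP r q) => [rq|qr].
  have -> : r %% (2 * q) = r by rewrite modn_small; lia.
  rewrite rq; have -> : gcdn r (q - 1) = gcdn r ((r - 1) * q + 1).
    apply: gcdn_opp; have -> : q - 1 + ((r - 1) * q + 1) = q * r.
      by case: r q => [|r'] [|q'] // in q1 r0 rp rn0 rq *; lia.
    exact: dvdn_mull.
  by apply: torus_perm_small; rewrite r0.
apply: (eq_orbit_count
  (g := torus_map q (rot_below r ((r - 1) * q)) (k.+1 * q + 1))).
- by move=> x; apply: torus_perm_lt.
- by move=> x xp; apply: torus_permE => //; nia.
(* [j] and [t] are the quotient and remainder of [k.+1 * q + 1 - r] by [q]. *)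
have [j [n [t [kE tq rE n0]]]] : exists j n t,
    [/\ k.+1 = n + j, t < q, r + t = n * q + 1 & 0 < n].
  have := divn_eq (k.+1 * q + 1 - r) q.
  have : (k.+1 * q + 1 - r) %% q < q by rewrite ltn_mod; lia.
  move: (_ %/ q) (_ %% q) => j t tq e.
  by exists j, (k.+1 - j), t; split=> //; nia.
have -> : k.+1 * q + 1 = n * q + 1 + j * q by lia.
apply: (torus_map_reduce_iter (@rot_below_lt r _) (@rot_below_id r _)); [nia..|].
have [[h nE]|[h nE]] : (exists h, n = 2 * h) \/ (exists h, n = 2 * h + 1).
  by case/boolP: (odd n) => o; [right|left]; exists n./2; lia.
- have h0 : 0 < h by lia.
  have pE : n * q + 1 = 2 * q * h + 1 by lia.
  have [t0|t0] := posnP t.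
    have rE' : r = 2 * q * h + 1 by lia.
    have -> : r %% (2 * q) = 1 by rewrite rE' mulnC modnMDl modn_small //; lia.
    have -> : n * q + 1 = r by lia.
    rewrite ifT; last lia.
    rewrite gcd1n.
    rewrite [X in orbit_count _ _ X](_ : 1 = gcdn r (2 * q)); last first.
      by rewrite rE' mulnC gcdnC gcdnMDl gcdn1.
    by apply: torus_perm_down_full => //; lia.
  have rE' : r = (h - 1) * (2 * q) + (2 * q + 1 - t) by nia.
  have t1 : 1 < t.
    case: (ltnP 1 t) => // t1; move: rn0; rewrite rE' modnMDl.
    by have -> : 2 * q + 1 - t = 2 * q by [lia]; rewrite modnn.
  have -> : r %% (2 * q) = 2 * q + 1 - t.
    by rewrite rE' modnMDl modn_small //; lia.
  rewrite ifF; last lia.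
  rewrite gcdnC; have -> : gcdn (q + 1) (2 * q + 1 - t + 2) =
      gcdn (q + 1) (t - 1).
    apply: gcdn_opp; have -> : 2 * q + 1 - t + 2 + (t - 1) = 2 * (q + 1) by lia.
    exact: dvdn_mull.
  rewrite gcdnC.
  by apply: (big_twist_even (t := t) t0 tq _ rE pE t1); nia.
- have pE : n * q + 1 = 2 * q * h + q + 1 by lia.
  have [t0|t0] := posnP t.
    have rE' : r = 2 * q * h + (q + 1) by lia.
    have -> : r %% (2 * q) = q + 1.
      by rewrite rE' mulnC modnMDl modn_small //; lia.
    have -> : n * q + 1 = r by lia.
    rewrite ifF; last lia.
    have <- : gcdn r (2 * q) = gcdn (q + 1 + 2) (q + 1).
      rewrite rE' mulnC gcdnC gcdnMDl gcdnC [RHS]gcdnC gcdnDl.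
      apply: gcdn_opp; have -> : 2 * q + 2 = 2 * (q + 1) by lia.
      exact: dvdn_mull.
    by apply: torus_perm_down_full => //; lia.
  (* [n = 1] would give [r + t = q + 1], impossible for [r > q] and [t > 0]. *)
  have h0 : 0 < h by nia.
  have rE' : r = h * (2 * q) + (q + 1 - t) by nia.
  have -> : r %% (2 * q) = q + 1 - t.
    by rewrite rE' modnMDl modn_small //; lia.
  rewrite ifT; last lia.
  have -> : gcdn (q + 1 - t) (q - 1) =
      gcdn (q + 1 - t) (q + 1 + 2 * q * (q + 1 - t - 1)).
    apply: gcdn_opp.
    have -> : q - 1 + (q + 1 + 2 * q * (q + 1 - t - 1)) = 2 * q * (q + 1 - t).
      by nia.
    exact: dvdn_mull.
  by apply: (big_twist_odd (t := t) t0 tq _ rE pE); nia.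
Qed.
End TorusPermutation.

(** * Components of a closed braid *)

Lemma continuous_pair (S T U : topologicalType) (f : S -> T) (g : S -> U)
    (x : S) :
  {for x, continuous f} -> {for x, continuous g} ->
  {for x, continuous (fun u => (f u, g u))}.
Proof.
move=> cf cg.
exact: (@cvg_pair _ _ _ (nbhs x) (nbhs (f x)) (nbhs (g x)) _ _ _ f g cf cg).
Qed.

Section Components.
Variable R : realType.
Implicit Types (L : set (R * R * R)).

(** Each [K c] is clopen in [L], the other pieces being finitely many closed sets; a component
    meeting [K c] therefore lies in it. *)
Lemma card_link_components L (K : nat -> set (R * R * R)) (N : nat) :
  L = \bigcup_(c in `I_N) K c ->
  (forall c, (c < N)%N -> closed (K c)) ->
  (forall c, (c < N)%N -> K c !=set0) ->
  (forall c d, (c < N)%N -> (d < N)%N -> K c `&` K d !=set0 -> c = d) ->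
  (forall c, (c < N)%N -> forall x y, K c x -> K c y ->
     connected_component L x y) ->
  #|` fset_set (link_components L)|%fset = N.
Proof.
move=> LE Kcl K0 Kdisj Kconn.
have comp c x : (c < N)%N -> K c x -> connected_component L x = K c.
  move=> cN Kx; apply/seteqP; split=> [|y Ky]; last exact: Kconn cN _ _ Kx Ky.
  set A := connected_component L x.
  suff <- : A `&` K c = A by exact: subIsetr.
  apply: (@component_connected _ L x).
  - by exists x; split=> //; apply: connected_component_refl; rewrite LE; exists c.
  - exists (~` \bigcup_(d in `I_N `\ c) K d).
      apply: closed_openC; apply: closed_bigcup => [|d [dN _]]; last exact: Kcl.
      exact: finite_setD.
    apply/seteqP; split=> y [Ay Ky]; split=> //.
      by move=> [d [dN dc] Kd]; apply: dc; apply: Kdisj => //; exists y.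
    have := @connected_component_sub _ L x y Ay; rewrite LE => -[d dN Kd].
    have [<-//|/eqP dc] := eqVneq d c.
    by exfalso; apply: Ky; exists d => //; split.
  - by exists (K c) => //; exact: Kcl.
apply: card_fset_set.
have -> : link_components L = K @` `I_N.
  apply/seteqP; split=> [_ [x Lx <-]|_ [c cN <-]].
    by move: Lx; rewrite LE => -[c cN Kx]; exists c => //; rewrite -LE (comp c).
  have [x Kx] := K0 c cN; exists x; last exact: comp.
  by rewrite LE; exists c.
apply: inj_card_eq => c d; rewrite !inE => cN dN e.
have [x Kx] := K0 c cN.
by apply: Kdisj => //; exists x; split; rewrite // -e.
Qed.
End Components.

(** * Strands of a closed braid, sector by sector *)

Section BraidStates.
Variables (p : nat) (w : braid_word).
Implicit Types s : nat * nat.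

(* [(k, j)] is the strand entering sector [k] at position [j]. *)
Definition braid_state s : Prop := (s.1 < (size w).+1)%N /\ (1 <= s.2 <= p)%N.

(** The last sector carries no letter: a strand keeps its position while the sector index wraps to
    0. *)
Definition braid_step s : nat * nat :=
  ((s.1.+1 %% (size w).+1)%N, exit_position (onth w s.1) s.2).

Definition letters_below : bool := all (fun a : letter => 0 < a.1 < p)%N w.

Lemma exit_position_range k j : letters_below -> (1 <= j <= p)%N ->
  (1 <= exit_position (onth w k) j <= p)%N.
Proof.
move=> /allP wp jp; case E: (onth w k) => [[i b]|//] /=.
have /wp /= : (i, b) \in w by apply/onthP; exists k.
by repeat case: eqP; lia.
Qed.

Lemma braid_step_state s : letters_below -> braid_state s ->
  braid_state (braid_step s).
Proof.
by move=> wp [sk sj]; split; rewrite /= ?ltn_mod //; exact: exit_position_range.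
Qed.

Lemma finite_braid_states : finite_set [set s | braid_state s].
Proof.
apply: (@sub_finite_set _ _ (`I_(size w).+1 `*` `I_p.+1)).
  by move=> [k j] [/= ks /andP[_ jp]]; split.
exact: finite_setX.
Qed.
End BraidStates.

Section Arcs.
Variables (R : realType) (w : braid_word).
Implicit Types (s : nat * nat) (u : R).

Definition sector_angle (k : nat) u : R := 2 * pi * (k%:R + u) / (size w).+1%:R.

Definition arc_point s u : R * R * R :=
  ((strand (onth w s.1) s.2 u).1 * cos (sector_angle s.1 u),
   (strand (onth w s.1) s.2 u).1 * sin (sector_angle s.1 u),
   (strand (onth w s.1) s.2 u).2).

Definition strand_arc s : set (R * R * R) := arc_point s @` `[0, 1].

Lemma closed_braid_arcs p : closed_braid R p w =
  \bigcup_(s in [set s | braid_state p w s]) strand_arc s.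
Proof.
apply/seteqP; split=> P.
  move=> [k [j [u [kw jp u01]]]]; case E: (strand (onth w k) j u) => [x y] /= PE.
  exists (k, j); first by split.
  by exists u; rewrite /= ?in_itv //= /arc_point E.
move=> [[k j] [/= kw jp]] [u]; rewrite /= in_itv /= => u01 <-.
by exists k, j, u; split=> //; rewrite /arc_point /=.
Qed.

Lemma arc_point_continuous s : continuous (arc_point s).
Proof.
have c_strand1 (a : option letter) j (x : R) :
    {for x, continuous (fun u => (strand a j u).1)}.
  apply: cvgD; apply: cvgM; [|exact: cvg_cst|exact: cvg_id|exact: cvg_cst].
  by apply: cvgB; [exact: cvg_cst|exact: cvg_id].
have c_strand2 (a : option letter) j (x : R) :
    {for x, continuous (fun u => (strand a j u).2)}.
  case: a => [[i b]|] /=; last exact: cvg_cst.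
  case: (j == i); last exact: cvg_cst.
  apply: cvgM; first exact: cvg_cst.
  apply: cvgM; first exact: cvg_id.
  by apply: cvgB; [exact: cvg_cst|exact: cvg_id].
have c_angle (x : R) : {for x, continuous (sector_angle s.1)}.
  apply: cvgM; last exact: cvg_cst.
  by apply: cvgM; [exact: cvg_cst|apply: cvgD; [exact: cvg_cst|exact: cvg_id]].
move=> x; pose X u := (strand (onth w s.1) s.2 u).1.
apply: (@continuous_pair _ _ _
  (fun u => (X u * cos (sector_angle s.1 u), X u * sin (sector_angle s.1 u)))
  (fun u => (strand (onth w s.1) s.2 u).2)); last exact: c_strand2.
apply: (@continuous_pair _ _ _ (fun u => X u * cos (sector_angle s.1 u))
  (fun u => X u * sin (sector_angle s.1 u)));
  apply: cvgM; try exact: c_strand1.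
  by apply: (continuous_comp (c_angle x)); exact: continuous_cos.
by apply: (continuous_comp (c_angle x)); exact: continuous_sin.
Qed.

Lemma strand_arc_closed s : closed (strand_arc s).
Proof.
apply: compact_closed; first exact: norm_hausdorff.
apply: continuous_compact; last exact: segment_compact.
exact/continuous_subspaceT/arc_point_continuous.
Qed.

Lemma strand_arc_connected s : connected (strand_arc s).
Proof.
apply: connected_continuous_connected; first exact: segment_connected.
exact/continuous_subspaceT/arc_point_continuous.
Qed.

Lemma strand_arc_start s : strand_arc s (arc_point s 0).
Proof. by exists 0 => //; rewrite /= in_itv /= lexx ler01. Qed.

(** At both ends of a slab the third coordinate vanishes and the radius is the position; after the
    last sector the angles [2 * pi] and 0 agree. *)
Lemma arc_point_end s : (s.1 < (size w).+1)%N ->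
  arc_point s 1 = arc_point (braid_step w s) 0.
Proof.
case: s => k j /= kw.
have n0 : (size w).+1%:R != 0 :> R by rewrite pnatr_eq0.
have s1 a i : strand a i (1 : R) = ((exit_position a i)%:R, 0).
  rewrite /strand subrr mul0r add0r mul1r; congr pair.
  by case: a => [[i' b]|//]; rewrite mulr0 mulr0; case: ifP.
have s0 a i : strand a i (0 : R) = (i%:R, 0).
  rewrite /strand subr0 mul0r mul1r addr0; congr pair.
  by case: a => [[i' b]|//]; rewrite mul0r mulr0; case: ifP.
rewrite /arc_point s1 s0 /=.
have [-> ->//] :
  cos (sector_angle k 1) = cos (sector_angle (k.+1 %% (size w).+1) 0) /\
  sin (sector_angle k 1) = sin (sector_angle (k.+1 %% (size w).+1) 0).
  rewrite /sector_angle natr1 addr0.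
  have [kE|kn] := eqVneq k.+1 (size w).+1.
    rewrite kE modnn mulr0 mul0r mulfK // cos0 sin0.
    by rewrite mulr_natl cos2pi -[X in sin X]add0r sinD2pi sin0.
  by rewrite modn_small // ltn_neqAle kn.
Qed.

End Arcs.
Arguments strand_arc : clear implicits.

(** * Injectivity of the arcs and the component count *)

Section ArcsDisjoint.
Variable R : realType.

Lemma nat_add_inj (k k' : nat) (u u' : R) :
  0 <= u < 1 -> 0 <= u' < 1 -> k%:R + u = k'%:R + u' -> k = k' /\ u = u'.
Proof.
move=> u01 u'01 e; suff kk' : k = k' by split=> //; move: e; rewrite kk'; lra.
have lt a b : (a%:R : R) < b%:R + 1 -> (a <= b)%N.
  by rewrite natr1 ltr_nat ltnS.
by apply/eqP; rewrite eqn_leq; apply/andP; split; apply: lt; lra.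
Qed.

Lemma cos_sin_inj (a b : R) : 0 <= a < 2 * pi -> 0 <= b < 2 * pi ->
  cos a = cos b -> sin a = sin b -> a = b.
Proof.
wlog ab : a b / a <= b => [W|] a2 b2 ec es.
  by case/orP: (le_total a b) => h; [exact: W|apply/esym; exact: W].
have [//|lt_ab] := eqVneq a b; exfalso.
have ab' : a < b by rewrite lt_neqAle lt_ab.
(* Half the difference lies strictly between 0 and [pi], yet its sine must vanish because
   [cos (b - a) = 1]. *)
have : 0 < sin ((b - a) / 2).
  by apply: sin_gt0_pi; lra.
have : cos ((b - a) / 2 *+ 2) = 1.
  have -> : (b - a) / 2 *+ 2 = b - a by rewrite mulr2n -splitr.
  by rewrite cosB ec es -!expr2 cos2Dsin2.
rewrite cos_mulr2n cos2sin2 => h /lt0r_neq0 /eqP; apply.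
by apply/eqP; rewrite -sqrf_eq0; apply/eqP; move: h; rewrite !mulr2n; lra.
Qed.

Lemma polar_inj (x y a b : R) : 0 < x -> 0 < y ->
  0 <= a < 2 * pi -> 0 <= b < 2 * pi ->
  x * cos a = y * cos b -> x * sin a = y * sin b -> x = y /\ a = b.
Proof.
move=> x0 y0 a2 b2 ec es.
have sq (z t : R) : z ^+ 2 = (z * cos t) ^+ 2 + (z * sin t) ^+ 2.
  by rewrite !exprMn -mulrDr cos2Dsin2 mulr1.
have xy : x = y.
  apply/eqP; rewrite -(@eqrXn2 _ 2) ?ltW //; apply/eqP.
  by rewrite (sq x a) (sq y b) ec es.
split=> //; move: ec es; rewrite xy => ec es.
by apply: cos_sin_inj => //; apply: (mulfI (lt0r_neq0 y0)).
Qed.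

(** Distinct strands have equal radius only at a crossing, for [u = 1 / 2], and there one of them is
    pushed off by [u * (1 - u)]. *)
Lemma strand_inj a j j' (u : R) : 0 <= u < 1 ->
  strand a j u = strand a j' u -> j = j'.
Proof.
move=> u01.
have par (m : nat) : (1 - u) * m%:R + u * m%:R = m%:R by ring.
case: a => [[i b]|]; rewrite /strand /=; last first.
  by rewrite !par => -[/eqP]; rewrite eqr_nat => /eqP.
have nb (z : R) : (-1) ^+ b * z = 0 -> z = 0.
  case: b; rewrite ?expr1 ?expr0 ?mulN1r ?mul1r // => /eqP.
  by rewrite oppr_eq0 => /eqP.
have z01 : 0 <= (0 : R) < 1 by rewrite lexx ltr01.
have first (m : nat) : (1 - u) * i%:R + u * i.+1%:R = m%:R -> m = i.
  rewrite -[i.+1%:R]natr1 => e; have [|//] := @nat_add_inj m i 0 u z01 u01.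
  by rewrite -e; ring.
have second (m : nat) : (1 - u) * i.+1%:R + u * i%:R = m%:R ->
    m = i.+1 \/ m = i.
  rewrite -[i.+1%:R]natr1 => e; have [u0|u0] := eqVneq u 0.
    left; apply/eqP; rewrite -(eqr_nat R) -[i.+1%:R]natr1 -e u0.
    by apply/eqP; ring.
  have u0' : 0 < u by rewrite lt0r u0; lra.
  have u'01 : 0 <= 1 - u < 1 by lra.
  have [|mi _] := @nat_add_inj m i 0 (1 - u) z01 u'01; last by right.
  by rewrite -e; ring.
have cross : (1 - u) * i%:R + u * i.+1%:R = (1 - u) * i.+1%:R + u * i%:R ->
    u * (1 - u) <> 0.
  rewrite -[i.+1%:R]natr1 => e; have -> : u = 1 / 2 by lra.
  lra.
case: (eqVneq j i) => [->|ji]; case: (eqVneq j' i) => [->|ji'] //.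
- rewrite ?eqxx; case: (eqVneq j' i.+1) => [->|ji1] [].
    by move=> e /nb /(cross e).
  by rewrite par => /first.
- rewrite ?eqxx; case: (eqVneq j i.+1) => [->|ji1] [].
    by move=> e /esym /nb /(cross (esym e)).
  by rewrite par => /esym /first.
case: (eqVneq j i.+1) => [->|j1]; case: (eqVneq j' i.+1) => [->|j1'] // [].
- by rewrite par => /second [//|/eqP]; rewrite (negbTE ji').
- by rewrite par => /esym /second [//|/eqP]; rewrite (negbTE ji).
- by rewrite !par => /eqP; rewrite eqr_nat => /eqP.
Qed.

Variables (p : nat) (w : braid_word).
Implicit Types s : nat * nat.

(** Positions are at least 1, so the radius is positive and polar coordinates are unique; the angle
    gives [k + u], hence [k] and [u] because [u < 1]. *)
Lemma arc_point_inj s s' (u u' : R) : braid_state p w s -> braid_state p w s' ->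
  0 <= u < 1 -> 0 <= u' < 1 -> arc_point w s u = arc_point w s' u' -> s = s'.
Proof.
case: s s' => [k j] [k' j'] [/= kw jp] [/= kw' jp'] u01 u'01.
have pos a i (v : R) : (0 < i)%N -> 0 <= v < 1 -> 0 < (strand a i v).1.
  move=> i0 v01; rewrite /strand /=; apply: ltr_wpDr.
    by apply: mulr_ge0; [lra|exact: ler0n].
  by apply: mulr_gt0; [lra|rewrite ltr0n].
have pi0 : 0 < 2 * pi :> R by rewrite mulr_gt0 ?ltr0n ?pi_gt0.
have n0 : 0 < (size w).+1%:R :> R by rewrite ltr0n.
have ang i (v : R) : (i < (size w).+1)%N -> 0 <= v < 1 ->
    0 <= sector_angle w i v < 2 * pi.
  move=> iw v01; have iv : (i%:R : R) + 1 <= (size w).+1%:R.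
    by rewrite natr1 ler_nat.
  have i0 : 0 <= (i%:R : R) by exact: ler0n.
  rewrite /sector_angle ltr_pdivrMr // ltr_pM2l //; apply/andP; split; last lra.
  by apply: divr_ge0; [apply: mulr_ge0|]; [exact: ltW|lra|exact: ltW].
move=> [ec es ez].
have j0 : (0 < j)%N by case/andP: jp.
have j'0 : (0 < j')%N by case/andP: jp'.
have [ex ea] := polar_inj (pos _ _ _ j0 u01) (pos _ _ _ j'0 u'01)
  (ang _ _ kw u01) (ang _ _ kw' u'01) ec es.
have [kk' uu'] : k = k' /\ u = u'.
  apply: nat_add_inj => //; move: ea; rewrite /sector_angle.
  by move/(mulIf (invr_neq0 (lt0r_neq0 n0)))/(mulfI (lt0r_neq0 pi0)).
move: ex ez; rewrite -kk' -uu' => ex ez; congr pair.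
by apply: (@strand_inj (onth w k) _ _ u) => //; apply: injective_projections.
Qed.

Hypothesis wp : letters_below p w.

(** A point with [u = 1] is renamed as the start of the next arc, so that [arc_point_inj]
    applies. *)
Lemma arc_normal s P : braid_state p w s -> strand_arc R w s P ->
  exists s' u, [/\ braid_state p w s', (s' = s \/ s' = braid_step w s),
                   0 <= u < 1 & P = arc_point w s' u].
Proof.
move=> Ds [u /=]; rewrite in_itv /= => u01 <-.
have [u1|u1] := eqVneq u 1; last first.
  by exists s, u; split=> //; [left|rewrite lt_neqAle u1; lra].
exists (braid_step w s), 0; split; [exact: braid_step_state|by right|lra|].
by rewrite u1 arc_point_end //; case: Ds.
Qed.

(** The pieces are the unions of arcs with a given orbit label: consecutive arcs share an end point,
    and arcs with a common point have equal labels. *)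
Lemma closed_braid_components N :
  orbit_count (braid_state p w) (braid_step w) N ->
  #|` fset_set (link_components (closed_braid R p w))|%fset = N.
Proof.
move=> [lab [labN labS labE]].
have labF s : braid_state p w s -> lab (braid_step w s) = lab s.
  move=> Ds; apply/labE => //; first exact: braid_step_state.
  exact: merge_orbits_step.
apply: (@card_link_components _ _ (fun c =>
  \bigcup_(s in [set s | braid_state p w s /\ lab s = c]) strand_arc R w s)).
- rewrite closed_braid_arcs; apply/seteqP; split=> P.
    by move=> [s Ds Ps]; exists (lab s); [exact: labN|exists s].
  by move=> [c _ [s [Ds _] Ps]]; exists s.
- move=> c _; apply: closed_bigcup => [|s _]; last exact: strand_arc_closed.
  by apply: sub_finite_set (finite_braid_states p w) => s [].
- move=> c /labS [s Ds sc]; exists (arc_point w s 0), s => //.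
  exact: strand_arc_start.
- move=> c d _ _ [P [[s [Ds <-] Ps] [s' [Ds' <-] Ps']]].
  have [t [u [Dt ts u01 Pt]]] := arc_normal Ds Ps.
  have [t' [u' [Dt' ts' u'01 Pt']]] := arc_normal Ds' Ps'.
  have tt' : t = t' by apply: (arc_point_inj Dt Dt' u01 u'01); rewrite -Pt -Pt'.
  have -> : lab s = lab t by case: ts => ->; rewrite ?labF.
  by rewrite tt'; case: ts' => ->; rewrite ?labF.
move=> c _ P Q [s [Ds sc] Ps] [s' [Ds' s'c] Qs'].
set L := closed_braid R p w.
have arcL t : braid_state p w t -> strand_arc R w t `<=` L.
  by move=> Dt x tx; rewrite /L closed_braid_arcs; exists t.
have arc_comp t x y : braid_state p w t -> strand_arc R w t x ->
    strand_arc R w t y -> connected_component L x y.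
  move=> Dt tx ty; exists (strand_arc R w t) => //.
  by split; [|exact: arcL|exact: strand_arc_connected].
have iter_comp t i : braid_state p w t -> connected_component L
    (arc_point w t 0) (arc_point w (iter i (braid_step w) t) 0) /\
    braid_state p w (iter i (braid_step w) t).
  move=> Dt; elim: i => [|i [IH Di]].
    by split=> //; apply: (arc_comp t) => //; exact: strand_arc_start.
  split; last exact: braid_step_state.
  apply: (connected_component_trans IH); apply: (arc_comp _ _ _ Di).
    exact: strand_arc_start.
  rewrite iterS -arc_point_end; last by case: Di.
  by exists 1 => //; rewrite /= in_itv /= ler01 lexx.
have [i [j e]] : merge_orbits (braid_step w) s s'.
  by apply/labE => //; rewrite s'c.
(* The path runs from [P] to the start of its arc, along the orbit to the common iterate, and back
   to [Q]. *)
apply: (connected_component_trans (y := arc_point w s 0)).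
  by apply: (arc_comp s) => //; exact: strand_arc_start.
apply: (connected_component_trans (y := arc_point w s' 0)); last first.
  by apply: (arc_comp s') => //; exact: strand_arc_start.
apply: (connected_component_trans (proj1 (iter_comp s i Ds))).
by rewrite e; apply: connected_component_sym;
  exact: (proj1 (iter_comp s' j Ds')).
Qed.
End ArcsDisjoint.

(** * The action of the braid word on positions *)

Section WordAction.
Local Open Scope nat_scope.
Implicit Types (w : braid_word) (m j x : nat).

Definition word_act w j : nat :=
  foldl (fun j a => exit_position (Some a) j) j w.

(** [drop k w] is the part of the braid still ahead of a strand entering sector [k]; it is empty in
    the closing sector. *)
Lemma word_act_step w k j : k <= size w ->
  word_act (drop k w) j = let s := braid_step w (k, j) in
    if s.1 == 0 then s.2 else word_act (drop s.1 w) s.2.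
Proof.
rewrite leq_eqVlt => /orP[/eqP ->|kw] /=.
  by rewrite modnn drop_size onth_default.
have -> : onth w k = Some (nth (0, false) w k).
  by rewrite onthE (nth_map (0, false)).
by rewrite modn_small //= (drop_nth (0, false) kw).
Qed.

(** The section is sector 0, reached by each strand after the rest of the word; the shift by one
    renumbers strands from 0. *)
Lemma orbit_count_braid p w N : letters_below p w ->
  orbit_count (fun x => x < p) (fun x => (word_act w x.+1).-1) N ->
  orbit_count (braid_state p w) (braid_step w) N.
Proof.
move=> wp; have act_range w' j : {subset w' <= w} -> 1 <= j <= p ->
    1 <= word_act w' j <= p.
  elim: w' j => //= a w' IH j sub jp; apply: IH => [b bw|].
    by apply: sub; rewrite inE bw orbT.
  have /onthP[k wk] := sub a (mem_head _ _).
  by have := exit_position_range k wp jp; rewrite wk.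
pose out s := if s.1 == 0 then s.2 else word_act (drop s.1 w) s.2.
have outE s : s.1 <= size w -> out (braid_step w s) = word_act (drop s.1 w) s.2.
  by case: s => k j /= kw; rewrite word_act_step.
apply: (orbit_count_return (iota := fun y => (0, y.+1))
  (rho := fun s => (out s).-1)
  (mu := fun s => if s.1 == 0 then 0 else (size w).+1 - s.1)).
- by move=> s; exact: braid_step_state.
- by move=> y yp; split.
- by [].
- by move=> y yp; rewrite outE //= drop0.
- move=> [k j] [/= kw jp]; rewrite /out /=.
  case: eqP => _; first lia.
  have : 1 <= word_act (drop k w) j <= p by apply: act_range => // a /mem_drop.
  lia.
- move=> [k j] [kw jp]; have [k0|k0] := posnP k.
    by left; rewrite k0 /out /=; congr pair; move: jp => /=; lia.
  right; rewrite outE // /out /= eqn0Ngt k0; split=> //.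
  have [->|kn] := eqVneq k (size w); first by rewrite modnn /= subSnn.
  by rewrite modn_small /=; move: kw kn => /=; lia.
Qed.

Lemma word_act_iter w n j :
  word_act (flatten (nseq n w)) j = iter n (word_act w) j.
Proof.
elim: n j => //= n IH j.
by rewrite /word_act foldl_cat -/(word_act _ _) IH -iterSr.
Qed.

(** The strand at [a] crosses the next [l] strands in turn, moving each down by one; so [row_word m]
    rotates by [-1]. *)
Lemma word_act_iota a l j : word_act [seq (i, false) | i <- iota a l] j =
  if j == a then a + l else if a < j <= a + l then j.-1 else j.
Proof.
elim: l a j => [|l IH] a j /=; first by repeat case: ifP; lia.
by rewrite -/(word_act _ _) IH; repeat case: ifP; lia.
Qed.

Lemma word_act_iota_inv a l j :
  word_act (rev [seq (i, true) | i <- iota a l]) j =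
  if j == a + l then a else if a <= j < a + l then j.+1 else j.
Proof.
elim: l a j => [|l IH] a j /=; first by repeat case: ifP; lia.
rewrite rev_cons /word_act foldl_rcons -/(word_act _ _) IH /=.
by repeat case: ifP; lia.
Qed.

Lemma word_act_row m x : 0 < m ->
  word_act (row_word m) x.+1 = (rot_below m (m - 1) x).+1.
Proof.
move=> m0; rewrite word_act_iota /rot_below.
case: (ltnP x m) => xm; last by repeat case: ifP; lia.
have := @modn_down m 1 x m0 xm; rewrite muln1 => ->.
by repeat case: ifP; lia.
Qed.

Lemma word_act_row_inv m x : 0 < m ->
  word_act (word_inv (row_word m)) x.+1 = (rot_below m 1 x).+1.
Proof.
move=> m0; rewrite /word_inv /row_word -map_comp word_act_iota_inv /rot_below.
case: (ltnP x m) => xm; last by repeat case: ifP; lia.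
have [xE|xn] := eqVneq x.+1 m; first by rewrite addn1 xE modnn;
  repeat case: ifP; lia.
by rewrite modn_small; repeat case: ifP; lia.
Qed.

Lemma rot_below_iter m d n x : iter n (rot_below m d) x = rot_below m (d * n) x.
Proof.
elim: n => [|n IH].
  by rewrite muln0 /rot_below addn0; case: ltnP => // h; rewrite modn_small.
rewrite iterS IH; case: (ltnP x m) => h; last by rewrite !rot_below_id.
rewrite {1}/rot_below rot_below_lt // /rot_below h modnDml.
by congr modn; lia.
Qed.

(** A natural representative of [-s] modulo [r]; [Negz n] is [-(n + 1)]. *)
Definition twist_shift (r : nat) (s : int) : nat :=
  match s with Posz n => (r - 1) * n | Negz n => n.+1 end.

Lemma word_act_exp m (s : int) x : 0 < m ->
  word_act (word_exp (row_word m) s) x.+1 =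
    (rot_below m (twist_shift m s) x).+1.
Proof.
move=> m0.
have it (g h : nat -> nat) n : (forall y, g y.+1 = (h y).+1) ->
    iter n g x.+1 = (iter n h x).+1.
  by move=> gh; elim: n => //= n ->.
case: s => n; rewrite word_act_iter.
  by rewrite (it _ _ _ (fun y => word_act_row y m0)) rot_below_iter.
by rewrite (it _ _ _ (fun y => word_act_row_inv y m0)) rot_below_iter mul1n.
Qed.

Lemma letters_below_exp p m (s : int) : m <= p ->
  letters_below p (word_exp (row_word m) s).
Proof.
move=> mp; have row : letters_below p (row_word m).
  by apply/allP => a /mapP[i]; rewrite mem_iota => ii -> /=; lia.
have fl n w : letters_below p w -> letters_below p (flatten (nseq n w)).
  by move=> wp; elim: n => //= n IH; rewrite /letters_below all_cat; apply/andP.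
case: s => n; apply: fl => //.
by rewrite /letters_below all_rev all_map.
Qed.

Lemma NC_torus_perm (R : realType) p (q : nat) r (s : int) N :
  0 < r <= p ->
  orbit_count (fun x => x < p) (torus_perm p q r (twist_shift r s)) N ->
  NC R p q r s = N.
Proof.
move=> /andP[r0 rp] cN.
have wp : letters_below p (twisted_torus_word p q r s).
  rewrite /letters_below all_cat.
  by apply/andP; split; apply: letters_below_exp.
apply: (closed_braid_components _ wp).
apply: (orbit_count_braid wp).
have E x : x < p -> (word_act (twisted_torus_word p q r s) x.+1).-1 =
    torus_perm p q r (twist_shift r s) x.
  move=> xp; rewrite /word_act foldl_cat -!/(word_act _ _).
  rewrite word_act_exp; last lia.
  by rewrite word_act_exp //= /torus_perm {2}/rot_below xp.
by apply: eq_orbit_count cN => // x xp; rewrite E //; exact: torus_perm_lt.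
Qed.
End WordAction.

Theorem theorem3p4 (R : realType) (p q r : nat)
    (hr : (0 < r)%N) (hrp : (r <= p)%N) (hq : (0 < q)%N)
    (hpq : (p %% q)%N = 1%N) :
  [/\ (1 <= r %% (2 * q) <= q)%N ->
        (NC R p q%:Z r q%:Z)%:Z = gcdz (r %% (2 * q))%N%:Z (1 - q%:Z),
      (q + 1 <= r %% (2 * q) <= 2 * q - 1)%N ->
        (NC R p q%:Z r q%:Z)%:Z
          = gcdz ((r %% (2 * q))%N%:Z + 2) (q%:Z + 1)
    & (1 < r <= q)%N ->
        (NC R p q%:Z r (- q%:Z))%:Z = gcdz r%:Z (q%:Z + 1)].
Proof.
have q1 : (1 < q)%N by case: q hq hpq => [|[]] // _; rewrite modn1.
have rp : (0 < r <= p)%N by rewrite hr.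
have pE : p = ((p %/ q) * q + 1)%N by rewrite {1}(divn_eq p q) hpq.
have down : (r %% (2 * q) != 0)%N -> NC R p q r q =
    (if r %% (2 * q) <= q then gcdn (r %% (2 * q)) (q - 1)
     else gcdn (r %% (2 * q) + 2) (q + 1))%N.
  move=> r0; apply: NC_torus_perm => //.
  (* A zero quotient means [p = r = 1], outside the reach of [torus_perm_down]; the single strand is
     one orbit. *)
  case: (p %/ q)%N pE => [|k] pE; last first.
    by rewrite pE in hrp *; exact: torus_perm_down.
  have r1 : r = 1%N by lia.
  rewrite pE r1 modn_small; last lia.
  rewrite hq gcd1n.
  apply: eq_orbit_count (@orbit_count_rotation 1 0 isT) => x x1.
    exact: torus_perm_lt.
  by rewrite modn1; apply/eqP; rewrite -leqn0 -ltnS; exact: torus_perm_lt.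
split=> [/andP[r1 rq]|/andP[r1 rq]|/andP[r1 rq]].
(* [gcdz] takes absolute values, turning [1 - q] into [q - 1]. *)
- rewrite down -?lt0n // rq /gcdz /=; congr (Posz (gcdn _ _)); lia.
- rewrite down -?lt0n; last lia.
  by rewrite ifF; [rewrite /gcdz; congr (Posz (gcdn _ _))|]; lia.
(* In this form [twist_shift] evaluates to [q]. *)
- have -> : - q%:Z = Negz q.-1 by rewrite NegzE prednK.
  rewrite (@NC_torus_perm _ _ _ _ _ (gcdn r (q + 1))) //.
  case: (p %/ q)%N pE => [|k] pE; first lia.
  by rewrite pE /= prednK //; apply: torus_perm_small; rewrite hr.
Qed.
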